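(* Let $n\ge 1$ be an integer and let $u_n(z)=1-(1-z)^n$. Then $S_n=u_n(\Delta)$, i.e. $S_n=\{\,1-(1-z)^n : z\in\Delta\,\}$.
   Context: $\Delta=\{z\in\mathbb{C}:|z|<1\}$ is the open unit disk. For a natural number $n$, $\mathcal{P}_n$ denotes the set of all polynomials $p(z)=a_n+a_{n-1}z+\dots+a_1z^{n-1}$ with complex coefficients $a_1,\dots,a_n$, $a_1\neq 0$, normalized by $p(1)=1$ (i.e. $a_1+\dots+a_n=1$). For $p\in\mathcal{P}_n$ put $S(p)=\{\mu\in\mathbb{C}: \text{all roots of } z^{n}-\mu p(z)\text{ lie in }\Delta\}$, and $S_n=\bigcup_{p\in\mathcal{P}_n}S(p)$. *)

(* Defs.v *)
From mathcomp Require Import all_boot all_order all_algebra.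
From mathcomp Require Import classical_sets reals.
From mathcomp Require Import complex.

Set Implicit Arguments.
Unset Strict Implicit.
Unset Printing Implicit Defensive.

Import Order.TTheory GRing.Theory Num.Theory.
Local Open Scope ring_scope.
Local Open Scope classical_set_scope.
Local Open Scope complex_scope.

(* The norm on [R[i]] takes its values in [R[i]], where [x < y] means that
   [y - x] is a positive real; on norms this is the usual order of the reals. *)
Definition unit_disk (R : realType) : set R[i] := [set z | `|z| < 1].
Arguments unit_disk : clear implicits.

(* The coefficient a_k of p(z) = a_n + a_(n-1) z + ... + a_1 z^(n-1) is
   [p`_(n - k)]. *)
Definition normalized_polys (R : realType) (n : nat) : set {poly R[i]} :=
  [set p : {poly R[i]} | [/\ (size p <= n)%N, p`_(n.-1) != 0 & p.[1] = 1]].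
Arguments normalized_polys : clear implicits.

Definition stable_set (R : realType) (n : nat) (p : {poly R[i]}) : set R[i] :=
  [set mu | forall z : R[i], root ('X^n - mu *: p) z -> unit_disk R z].

Definition stable_union (R : realType) (n : nat) : set R[i] :=
  \bigcup_(p in normalized_polys R n) stable_set n p.
Arguments stable_union : clear implicits.

Definition u_map (R : realType) (n : nat) (z : R[i]) : R[i] :=
  1 - (1 - z) ^+ n.

(* Main.v *)
(** If the monic polynomial [X^n - mu p] has roots [l_1, ..., l_n] in the disk,
    then evaluating it at 1 gives [1 - mu = \prod (1 - l_i)], so the point is to
    find a single [z] in the disk with [\prod (1 - l_i) = (1 - z)^n].  By
    induction it suffices to write [(1 - v)^m (1 - u)] as [(1 - z)^(m+1)], for
    [u, v] in the disk.  If no such [z] exists, then all roots [a_j] of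
    [f = (X - 1)^(m+1) - (v - 1)^m (u - 1)] lie outside the disk, while
    [f'(v) / f(v) = (m+1) / (v - u)] says that [1 / (v - u)] is the mean of the
    [1 / (v - a_j)].  The Moebius map
    [a |-> (1 - v^* a) / (v - a) = v^* + (1 - |v|^2) / (v - a)] sends the
    complement of the open disk into the closed disk and [u] outside of the
    latter, which contradicts the convexity of the closed disk.

    Conversely, [mu = 1 - (1 - z)^n <> 0] is reached by the [p] for which
    [X^n - mu p = (X - z)^n], and [mu = 0] by [p = X^(n-1)]. *)
Require Import Defs.
From mathcomp Require Import all_boot all_order all_algebra.
From mathcomp Require Import classical_sets reals.
From mathcomp Require Import complex.
From mathcomp Require Import ring.

Import Order.TTheory GRing.Theory Num.Theory.
Local Open Scope ring_scope.
Local Open Scope classical_set_scope.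
Local Open Scope complex_scope.

(** Logarithmic derivative, by the product rule. *)
Lemma deriv_prod_XsubC (F : fieldType) (s : seq F) (x : F) :
  x \notin s ->
  (\prod_(a <- s) ('X - a%:P))^`().[x] =
  (\prod_(a <- s) ('X - a%:P)).[x] * \sum_(a <- s) (x - a)^-1.
Proof.
elim: s => [|a s IHs]; first by rewrite !big_nil derivE horner0 mulr0.
rewrite inE negb_or => /andP[x_neq_a /IHs {}IHs].
rewrite !big_cons derivM derivXsubC hornerD !hornerM IHs !hornerE mulrDr.
by rewrite mulrAC divff ?subr_eq0 // mul1r.
Qed.

(** The cross terms cancel; for [v] in the disk, the sign is that of [1 - |a|^2]. *)
Lemma blaschke_normC (C : numClosedFieldType) (v a : C) :
  `|1 - v^* * a| ^+ 2 - `|v - a| ^+ 2 = (1 - `|v| ^+ 2) * (1 - `|a| ^+ 2).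
Proof. by rewrite !normCK !rmorphB rmorphM rmorph1 /= conjCK; ring. Qed.

Lemma blaschke_le1 (C : numClosedFieldType) (v a : C) :
  `|v| < 1 -> v != a ->
  (`|v^* + (1 - `|v| ^+ 2) / (v - a)| <= 1) = (1 <= `|a|).
Proof.
move=> v_lt1 v_neq_a; have va0 : v - a != 0 by rewrite subr_eq0.
have -> : v^* + (1 - `|v| ^+ 2) / (v - a) = (1 - v^* * a) / (v - a).
  by rewrite normCK; field.
rewrite normrM normfV ler_pdivrMr ?normr_gt0 // mul1r.
rewrite -[LHS](@ler_pXn2r _ 2) ?nnegrE // -[LHS]subr_le0 blaschke_normC.
by rewrite pmulr_rle0 ?subr_gt0 ?expr_lt1 // subr_le0 expr_ge1.
Qed.

Lemma coincidence_step (C : numClosedFieldType) (m : nat) (u v : C) :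
  `|u| < 1 -> `|v| < 1 ->
  exists2 z : C, `|z| < 1 & (z - 1) ^+ m.+1 = (u - 1) * (v - 1) ^+ m.
Proof.
move=> u_lt1 v_lt1; pose c := (u - 1) * (v - 1) ^+ m.
pose f : {poly C} := ('X - 1%:P) ^+ m.+1 - c%:P.
have size_f : size f = m.+2.
  by rewrite size_polyDl size_exp_XsubC // size_polyN size_polyC; case: eqP.
have f_monic : f \is monic.
  apply/monicP; rewrite lead_coefDl ?size_exp_XsubC.
    exact/monicP/monic_exp/monicXsubC.
  by rewrite size_polyN size_polyC; case: eqP.
have [s f_eq] := closed_field_poly_normal f.
rewrite (monicP f_monic) scale1r in f_eq.
have size_s : size s = m.+1.
  by apply: succn_inj; rewrite -size_f f_eq size_prod_XsubC.
have horner_f x : f.[x] = (x - 1) ^+ m.+1 - c by rewrite !hornerE.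
have [/hasP[z zs z_lt1]|/hasPn s_ge1] := boolP (has (fun z => `|z| < 1) s).
  exists z => //; apply/eqP; rewrite -subr_eq0 -/c -horner_f f_eq.
  by rewrite -/(root _ _) root_prod_XsubC.
have v_s : v \notin s by apply/negP => /s_ge1; rewrite v_lt1.
have fv : f.[v] = (v - 1) ^+ m * (v - u) by rewrite horner_f exprS /c; ring.
have fv0 : f.[v] != 0 by rewrite f_eq -/(root _ _) root_prod_XsubC.
have vu0 : v - u != 0 by apply: contraNneq fv0 => vu; rewrite fv vu mulr0.
(* Both sides are [f'(v)], computed from the power and from the roots. *)
have dfv : (m.+1%:R : C) * (v - 1) ^+ m = f.[v] * \sum_(a <- s) (v - a)^-1.
  rewrite f_eq -(deriv_prod_XsubC _ _ _ v_s) -f_eq derivB derivC subr0.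
  by rewrite deriv_exp derivXsubC mul1r hornerMn !hornerE mulr_natl.
have mean_inv : m.+1%:R / (v - u) = \sum_(a <- s) (v - a)^-1.
  by apply: (mulfI fv0); rewrite -dfv fv; field.
pose B a := v^* + (1 - `|v| ^+ 2) / (v - a).
(* [B] is affine in [1 / (v - a)], so it preserves the mean over the [m + 1] roots. *)
have mean_B : m.+1%:R * B u = \sum_(a <- s) B a.
  rewrite big_split -mulr_sumr -mean_inv big_const_seq count_predT size_s.
  by rewrite iter_addr_0 mulrDr mulr_natl mulrCA.
have : `|B u| <= 1.
  rewrite -(@ler_pM2l _ m.+1%:R) ?ltr0Sn // mulr1 -normr_nat -normrM mean_B.
  apply: le_trans (ler_norm_sum _ _ _) _.
  have <- : \sum_(a <- s) 1 = `|m.+1%:R| :> C.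
    by rewrite normr_nat big_const_seq count_predT size_s iter_addr_0.
  rewrite big_seq [leRHS]big_seq; apply: ler_sum => a a_s.
  have v_neq_a : v != a by apply: contraNneq v_s => ->.
  by rewrite blaschke_le1 // real_leNgt ?normr_real ?real1 ?s_ge1.
have v_neq_u : v != u by rewrite -subr_eq0.
by rewrite blaschke_le1 // real_leNgt ?normr_real ?real1 ?u_lt1.
Qed.

Lemma prod_disk_coincidence (C : numClosedFieldType) (s : seq C) :
  (forall a, a \in s -> `|a| < 1) ->
  exists2 z : C, `|z| < 1 & \prod_(a <- s) (1 - a) = (1 - z) ^+ size s.
Proof.
elim: s => [|u s IHs] s_lt1; first by exists 0; rewrite ?normr0 ?big_nil.
have [|v v_lt1 prod_s] := IHs.
  by move=> a a_s; rewrite s_lt1 ?inE ?a_s ?orbT.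
have u_lt1 : `|u| < 1 by rewrite s_lt1 ?mem_head.
have [z z_lt1 z_eq] := coincidence_step C (size s) u v u_lt1 v_lt1.
(* Both sides carry the same sign [(-1)^(m+1)], where [m = size s]. *)
exists z => //; rewrite big_cons prod_s -(opprB u) -(opprB v) -(opprB z).
by rewrite /= [RHS]exprNn z_eq [in LHS]exprNn exprS; ring.
Qed.

Theorem theorem1 (R : realType) (n : nat) (hn : (1 <= n)%N) :
  stable_union R n = u_map n @` unit_disk R.
Proof.
apply/seteqP; split=> [mu [p [size_p _ p1] stab] | _ [z z_lt1 <-]].
- have size_mup : (size (- (mu *: p)) < size ('X^n : {poly R[i]}))%N.
    rewrite size_polyXn size_polyN ltnS.
    exact: leq_trans (size_scale_leq _ _) size_p.
  have f_monic : 'X^n - mu *: p \is monic.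
    by apply/monicP; rewrite lead_coefDl // lead_coefXn.
  have [s f_eq] := closed_field_poly_normal ('X^n - mu *: p).
  rewrite (monicP f_monic) scale1r in f_eq.
  have size_s : size s = n.
    apply: succn_inj; rewrite -(size_prod_XsubC s id) -f_eq size_polyDl //.
    by rewrite size_polyXn.
  have [a a_s|z z_lt1 prod_s] := prod_disk_coincidence _ s.
    by apply: stab; rewrite f_eq root_prod_XsubC.
  exists z => //; rewrite /u_map -size_s -prod_s.
  have -> : \prod_(a <- s) (1 - a) = (\prod_(a <- s) ('X - a%:P)).[1].
    by rewrite horner_prod; apply: eq_bigr => a _; rewrite hornerXsubC.
  by rewrite -f_eq !hornerE p1 expr1n; ring.
- have [mu0|mu_neq0] := eqVneq (u_map n z) 0.
    exists 'X^(n.-1).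
      split; rewrite ?size_polyXn ?prednK ?coefXn ?eqxx ?oner_eq0 //.
      by rewrite hornerXn expr1n.
    move=> w; rewrite mu0 scale0r subr0 /root hornerXn expf_eq0.
    move=> /andP[_ /eqP->].
    by rewrite /unit_disk /= normr0 ltr01.
  have z_neq0 : z != 0.
    by apply: contraNneq mu_neq0 => ->; rewrite /u_map subr0 expr1n subrr.
  (* [q(1)] is [u_map n z], so dividing by it normalizes [q]. *)
  pose q : {poly R[i]} := 'X^n - ('X - z%:P) ^+ n.
  have q_eq : 'X^n - q = ('X - z%:P) ^+ n by rewrite /q; ring.
  exists ((u_map n z)^-1 *: q); last first.
    move=> w; rewrite scalerA divff // scale1r q_eq.
    by rewrite /root !hornerE expf_eq0 hn subr_eq0 => /eqP ->.
  split.
  + apply: leq_trans (size_scale_leq _ _) _.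
    (* In degree [n] the two leading coefficients cancel. *)
    apply/leq_sizeP => j; rewrite leq_eqVlt => /orP[/eqP <-|n_lt_j].
      have /monicP := monic_exp n (monicXsubC z).
      rewrite lead_coefE size_exp_XsubC /= => Xz.
      by rewrite coefB coefXn eqxx Xz subrr.
    rewrite nth_default // (leq_trans (size_polyD _ _)) // size_polyN.
    by rewrite size_polyXn size_exp_XsubC maxnn.
  (* By Vieta, [q] has coefficient [n z] in degree [n - 1], nonzero since [z] is. *)
  + have Xz : \prod_(a <- nseq n z) ('X - a%:P) = ('X - z%:P) ^+ n.
      by rewrite big_nseq -Monoid.iteropE.
    have := @coefPn_prod_XsubC _ (nseq n z).
    rewrite size_nseq Xz big_nseq iter_addr_0 -lt0n => /(_ hn) coef_Xz.
    rewrite coefZ coefB coefXn coef_Xz ltn_eqF ?prednK // sub0r opprK.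
    by rewrite mulf_neq0 ?invr_eq0 // mulrn_eq0 negb_or -lt0n hn.
  + by rewrite !hornerE expr1n mulVf.
Qed.
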